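(* Let $A$ be an $n\times n$ complex Hermitian positive definite matrix, $b,x_0\in\mathbb{C}^n$ with $x_0\neq x:=A^{-1}b$, $\kappa_{\max}>1$ a real number, and $N\ge 1$ an integer (the number of iterations) with $N<n$. Then one can choose Hermitian positive definite matrices $B_0,\dots,B_{N-1}$ with $\kappa(B_k^{-1}A)\le\kappa_{\max}$ for $k=0,\dots,N-1$ such that, for every sequence of integers $m_0,m_1,\dots$ with $0\le m_k\le k$ and $m_{k+1}\le m_k+1$, the method described in the context with $A,b,x_0,\{B_k\},\{m_k\}$ turns into the PSD method (i.e. for all $k=0,\dots,N-1$ one has $p_k=s_k$, and the iterates coincide with those of the same method with $m_k=0$ for all $k$), and on every iteration $k=0,\dots,N-1$ $$\frac{\|e_{k+1}\|_A}{\|e_k\|_A}=\frac{\kappa_{\max}-1}{\kappa_{\max}+1}.$$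
   Context: $(\cdot,\cdot)$ is the standard Hermitian inner product on $\mathbb{C}^n$, taken linear in the first argument; $(x,y)_A=(Ax,y)$ and $\|x\|_A=\sqrt{(x,x)_A}$. For Hermitian positive definite $A$ and $B$, the eigenvalues of $B^{-1}A$ are real positive and $\kappa(B^{-1}A)=\lambda_{\max}(B^{-1}A)/\lambda_{\min}(B^{-1}A)$. The method: given $A$, $b$, preconditioners $\{B_k\}$, integers $\{m_k\}$ and an initial guess $x_0$, for $k=0,1,\dots$ compute $r_k=b-Ax_k$, $s_k=B_k^{-1}r_k$, and $$p_k=s_k-\sum_{l=k-m_k}^{k-1}\frac{(As_k,p_l)}{(Ap_l,p_l)}p_l,\qquad x_{k+1}=x_k+\frac{(r_k,p_k)}{(Ap_k,p_k)}p_k .$$ The error is $e_k=x-x_k$, where $x=A^{-1}b$. The preconditioned steepest descent (PSD) method is the case $m_k=0$ for all $k$, in which $p_k=s_k$. *)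

(* Defs.v *)
From HB Require Import structures.
From mathcomp Require Export all_boot all_order all_algebra.
From mathcomp Require Export sesquilinear spectral.
From mathcomp Require Export complex.
From mathcomp Require Export boolp classical_sets reals.
Set Implicit Arguments.
Unset Strict Implicit.
Unset Printing Implicit Defensive.
Import Order.TTheory GRing.Theory Num.Theory.
Local Open Scope ring_scope.
Local Open Scope sesquilinear_scope.
Local Open Scope complex_scope.

Section Algebra.
Variables (R : realType) (n : nat).
Implicit Types (A B M : 'M[R[i]]_n) (x y : 'cV[R[i]]_n).

(* Linear in the first argument: dotc x y = \sum_i x_i (y_i)^*. *)
Definition dotc x y : R[i] := (y ^t* *m x) 0 0.

Lemma dotcE x y : dotc x y = \sum_i x i 0 * (y i 0)^*%R.
Proof. by rewrite /dotc mxE; apply: eq_bigr => i _; rewrite !mxE mulrC. Qed.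

Definition dotA A x y : R[i] := dotc (A *m x) y.

(* When A is Hermitian positive definite, dotA A x x is real and nonnegative,
   so taking its real part only changes the type from R[i] to R. *)
Definition normA A x : R := Num.sqrt (complex.Re (dotA A x x)).

(* In the order of R[i], 0 < z means that z is real and positive. *)
Definition hpd A : Prop :=
  A \is hermsymmx /\ forall x, x != 0 -> 0 < dotc (A *m x) x.

(* The real eigenvalues of M; for M = B^-1 A with A and B Hermitian positive
   definite these are all the eigenvalues. *)
Definition spectrum M : set R := [set l : R | eigenvalue M l%:C]%classic.

(* The spectrum is finite, so for 0 < n and M = B^-1 A as above the supremum
   and the infimum are the largest and the smallest eigenvalue. *)
Definition lambda_max M : R := sup (spectrum M).
Definition lambda_min M : R := inf (spectrum M).
Definition kappa M : R := lambda_max M / lambda_min M.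

End Algebra.

Section Method.
Variables (R : realType) (n : nat).
Variables (A : 'M[R[i]]_n) (b : 'cV[R[i]]_n) (B : nat -> 'M[R[i]]_n).
Variables (m : nat -> nat) (x0 : 'cV[R[i]]_n).

(* The state before iteration k is (x_k, [:: p_0; ..; p_(k-1)]). *)
Definition pcg_residual (x : 'cV[R[i]]_n) := b - A *m x.

Definition pcg_precond (k : nat) (x : 'cV[R[i]]_n) :=
  invmx (B k) *m pcg_residual x.

Definition pcg_direction (k : nat) (x : 'cV[R[i]]_n)
    (ps : seq 'cV[R[i]]_n) : 'cV[R[i]]_n :=
  let s := pcg_precond k x in
  s - \sum_(k - m k <= l < k)
        (dotc (A *m s) ps`_l / dotc (A *m ps`_l) ps`_l) *: ps`_l.

Definition pcg_step (k : nat) (st : 'cV[R[i]]_n * seq 'cV[R[i]]_n) :=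
  let: (x, ps) := st in
  let p := pcg_direction k x ps in
  (x + (dotc (pcg_residual x) p / dotc (A *m p) p) *: p, rcons ps p).

Fixpoint pcg_state (k : nat) : 'cV[R[i]]_n * seq 'cV[R[i]]_n :=
  if k is k'.+1 then pcg_step k' (pcg_state k') else (x0, [::]).

Definition pcg_x (k : nat) : 'cV[R[i]]_n := (pcg_state k).1.
Definition pcg_r (k : nat) : 'cV[R[i]]_n := pcg_residual (pcg_x k).
Definition pcg_s (k : nat) : 'cV[R[i]]_n := pcg_precond k (pcg_x k).
Definition pcg_p (k : nat) : 'cV[R[i]]_n :=
  pcg_direction k (pcg_x k) (pcg_state k).2.

Lemma pcg_state2 k : (pcg_state k).2 = mkseq pcg_p k.
Proof.
elim: k => [//|k IHk]; rewrite mkseqS -IHk /= /pcg_p /pcg_x.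
by case: (pcg_state k).
Qed.

(* pcg_x, pcg_r, pcg_s and pcg_p satisfy the recurrences of the method. *)
Lemma pcg_x0 : pcg_x 0 = x0. Proof. by []. Qed.

Lemma pcg_rE k : pcg_r k = b - A *m pcg_x k. Proof. by []. Qed.

Lemma pcg_sE k : pcg_s k = invmx (B k) *m pcg_r k. Proof. by []. Qed.

Lemma pcg_pE k :
  pcg_p k = pcg_s k - \sum_(k - m k <= l < k)
    (dotc (A *m pcg_s k) (pcg_p l) / dotc (A *m pcg_p l) (pcg_p l))
      *: pcg_p l.
Proof.
rewrite {1}/pcg_p /pcg_direction -/(pcg_s k) pcg_state2; congr (_ - _).
by apply: eq_big_nat => l /andP[_ ltlk]; rewrite nth_mkseq.
Qed.

Lemma pcg_xS k :
  pcg_x k.+1 = pcg_x k +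
    (dotc (pcg_r k) (pcg_p k) / dotc (A *m pcg_p k) (pcg_p k)) *: pcg_p k.
Proof.
by rewrite /pcg_r /pcg_p {1}/pcg_x /= /pcg_x; case: (pcg_state k).
Qed.

Definition pcg_error (k : nat) : 'cV[R[i]]_n := invmx A *m b - pcg_x k.

End Method.

Definition psd_x (R : realType) (n : nat) (A : 'M[R[i]]_n) (b : 'cV[R[i]]_n)
    (B : nat -> 'M[R[i]]_n) (x0 : 'cV[R[i]]_n) (k : nat) : 'cV[R[i]]_n :=
  pcg_x A b B (fun=> 0%N) x0 k.

(* Main.v *)
Require Import Defs.
From mathcomp Require Import ring lra.
Set Implicit Arguments.
Unset Strict Implicit.
Unset Printing Implicit Defensive.
Import Order.TTheory GRing.Theory Num.Theory.
Local Open Scope ring_scope.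
Local Open Scope sesquilinear_scope.
Local Open Scope complex_scope.

(** Why the theorem is true.

    Work in the inner product of A, write e_k for the errors and q for
    (kappa_max - 1) / (kappa_max + 1).  The error curve is chosen before the
    preconditioners: one asks for vectors e_0, ..., e_N with the Gram matrix
    (e_j, e_k)_A = q^(2 max(j, k)) (e_0, e_0)_A.  They are built one at a
    time: e_(k+1) is q^2 e_k plus a multiple of a vector A-orthogonal to all
    the previous ones, which exists as long as k + 1 < n
    ([exists_dotA_gram]).  It follows from this Gram matrix that the norms
    decrease by the factor q, that the increments d_k = e_k - e_(k+1) are
    mutually A-orthogonal, and that each d_k is A-orthogonal to e_(k+1).

    Each increment is realised as a preconditioned residual.  The vectors e_k
    and f = e_(k+1) / q have the same A-norm and a real inner product, so the
    Householder reflection S along v = e_k - f, self-adjoint and unitary for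
    (.,.)_A, maps e_k to f.  Then T = 1 - q S has the spectrum {1 - q, 1 + q},
    whose ratio is kappa_max, and T e_k = d_k.  The matrix
      B_k^-1 = T A^-1 = (1 - q) A^-1 + 2 q / (v, v)_A  v v^*
    is visibly Hermitian positive definite ([exists_precond]).

    With these B_k the method has s_k = d_k.  Every orthogonalisation
    coefficient vanishes since the d_k are A-orthogonal, whatever m_k is, so
    p_k = s_k; and the step length is 1 since d_k is A-orthogonal to e_(k+1),
    so the next error is e_(k+1) ([pcg_follows]).  Taking m_k = 0 shows that
    the iterates are those of PSD. *)

(** * The inner product of a Hermitian positive definite matrix *)

Section EnergyForm.
Variables (R : realType) (n : nat).
Implicit Types (A B C : 'M[R[i]]_n) (x y z : 'cV[R[i]]_n) (a : R[i]).

Lemma trmxC_mul p q r (M : 'M[R[i]]_(p, q)) (P : 'M[R[i]]_(q, r)) :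
  (M *m P) ^t* = P ^t* *m M ^t*.
Proof. by rewrite trmx_mul map_mxM. Qed.

Lemma hermE A : (A \is hermsymmx) = (A^t* == A).
Proof. by rewrite is_hermitianmxE expr0 scale1r eq_sym. Qed.

Lemma dotcC x y : dotc y x = (dotc x y)^*%R.
Proof.
rewrite !dotcE rmorph_sum /=; apply: eq_bigr => i _.
by rewrite rmorphM /= conjCK mulrC.
Qed.

Lemma dotcDl x y z : dotc (x + y) z = dotc x z + dotc y z.
Proof. by rewrite /dotc mulmxDr mxE. Qed.

Lemma dotcZl a x y : dotc (a *: x) y = a * dotc x y.
Proof. by rewrite /dotc -scalemxAr mxE. Qed.

Lemma dotcMl A x y : dotc (A *m x) y = dotc x (A^t* *m y).
Proof. by rewrite /dotc trmxC_mul trmxCK mulmxA. Qed.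

Lemma rank1_mulmx x y z : z *m (y^t* *m x) = dotc x y *: z.
Proof. by rewrite [y^t* *m x]mx11_scalar mul_mx_scalar. Qed.

Variable A : 'M[R[i]]_n.
Hypothesis hA : hpd A.

Lemma hpd_herm : A^t* = A.
Proof. by apply/eqP; rewrite -hermE; case: hA. Qed.

Lemma dotAC x y : dotA A y x = (dotA A x y)^*%R.
Proof. by rewrite /dotA dotcMl hpd_herm dotcC. Qed.

Lemma dotADl x y z : dotA A (x + y) z = dotA A x z + dotA A y z.
Proof. by rewrite /dotA mulmxDr dotcDl. Qed.

Lemma dotAZl a x y : dotA A (a *: x) y = a * dotA A x y.
Proof. by rewrite /dotA -scalemxAr dotcZl. Qed.

Lemma dotABl x y z : dotA A (x - y) z = dotA A x z - dotA A y z.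
Proof. by rewrite dotADl -scaleN1r dotAZl mulN1r. Qed.

Lemma dotADr x y z : dotA A z (x + y) = dotA A z x + dotA A z y.
Proof. by rewrite dotAC dotADl rmorphD /= -!dotAC. Qed.

Lemma dotAZr a x y : dotA A x (a *: y) = a^*%R * dotA A x y.
Proof. by rewrite dotAC dotAZl rmorphM /= -dotAC. Qed.

Lemma dotABr x y z : dotA A z (x - y) = dotA A z x - dotA A z y.
Proof. by rewrite dotAC dotABl rmorphB /= -!dotAC. Qed.

Lemma dotA_gt0 x : x != 0 -> 0 < dotA A x x.
Proof. by case: hA => _; apply. Qed.

Lemma hpd_unit : A \in unitmx.
Proof.
rewrite unitmxE unitfE; apply/det0P => -[u u0 uA0].
have x0 : u^t* != 0.
  apply: contra u0 => /eqP ux; rewrite -(trmxCK u) ux.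
  by rewrite linear0 map_mx0.
by have := dotA_gt0 x0; rewrite /dotA /dotc trmxCK mulmxA uA0 mul0mx mxE ltxx.
Qed.

(** With x = A y, (A^-1 x, x) is (y, A y). *)
Lemma hpd_inv : hpd (invmx A).
Proof.
split; first by rewrite hermE trmx_inv map_invmx hpd_herm.
move=> x x0; have Ay : x = A *m (invmx A *m x) by rewrite mulKVmx ?hpd_unit.
rewrite {2}Ay -{2}hpd_herm -dotcMl; apply: dotA_gt0.
by apply: contra x0 => /eqP y0; rewrite Ay y0 mulmx0.
Qed.

(** Fewer than [n] linear conditions on [w] always leave a nonzero solution. *)
Lemma exists_dotA_orth (k : nat) (e : nat -> 'cV[R[i]]_n) : (k < n)%N ->
  exists2 w, w != 0 & forall j, (j < k)%N -> dotA A w (e j) = 0.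
Proof.
move=> ltkn; pose M := \matrix_(i < n, j < k) ((e j)^t* *m A) 0 i.
have : kermx M != 0.
  rewrite kermx_eq0 /row_free neq_ltn.
  by rewrite (leq_ltn_trans (rank_leq_col _)).
case/rowV0Pn => u /sub_kermxP uM u0; exists u^T.
  by apply: contra u0 => /eqP u0; rewrite -(trmxK u) u0 trmx0.
move=> j ltjk; rewrite /dotA /dotc mulmxA.
move/matrixP/(_ 0 (Ordinal ltjk)): uM; rewrite !mxE => uM.
by rewrite -[RHS]uM; apply: eq_bigr => i _; rewrite !mxE mulrC.
Qed.

(** Any positive nonincreasing sequence that starts at (e0, e0)_A is the
    squared norm curve of errors whose increments are mutually A-orthogonal
    and A-orthogonal to all later errors; both orthogonalities are encoded in
    the Gram matrix, whose (j, k) entry depends only on max(j, k).  The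
    geometric sequence is the case of interest. *)
Lemma exists_dotA_gram (e0 : 'cV[R[i]]_n) (g : nat -> R[i]) (N : nat) :
  g 0%N = dotA A e0 e0 -> (forall k, 0 < g k) -> (forall k, g k.+1 <= g k) ->
  (N < n)%N ->
  exists2 e : nat -> 'cV[R[i]]_n, e 0%N = e0 &
    forall j k, (j <= k <= N)%N -> dotA A (e k) (e j) = g k.
Proof.
move=> g0 g_gt0 g_le; elim: N => [|N IHN] ltNn.
  exists (fun=> e0) => // j k /andP[lejk]; rewrite leqn0 => /eqP k0.
  by rewrite k0 g0.
have [e e00 eG] := IHN (ltnW ltNn).
have [w w0 we] := exists_dotA_orth e ltNn.
have ww_gt0 := dotA_gt0 w0.
(* r is forced by the inner products with the previous vectors, c by the
   norm of the new one; g N.+1 <= g N makes the square root real. *)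
pose r := g N.+1 / g N.
pose c := sqrtC (g N.+1 * (1 - r) / dotA A w w).
have c_ge0 : 0 <= c.
  rewrite sqrtC_ge0 divr_ge0 ?(ltW ww_gt0) // mulr_ge0 ?(ltW (g_gt0 _)) //.
  by rewrite subr_ge0 /r ler_pdivrMr ?mul1r.
have r_ge0 : 0 <= r by rewrite divr_ge0 ?ltW.
pose f := r *: e N + c *: w.
have fe j : (j <= N)%N -> dotA A f (e j) = g N.+1.
  move=> lejN; rewrite dotADl !dotAZl we ?ltnS // mulr0 addr0 eG ?lejN ?leqnn //.
  by rewrite divfK ?gt_eqF.
have ff : dotA A f f = g N.+1.
  rewrite {2}/f dotADr !dotAZr fe // dotADl !dotAZl.
  rewrite (dotAC w) we ?ltnSn // conjC0 mulr0 add0r !geC0_conj // mulrA -expr2.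
  by rewrite sqrtCK divfK ?gt_eqF //; ring.
exists (fun j => if (j <= N)%N then e j else f); first by rewrite leq0n.
move=> j k /andP[lejk]; rewrite leq_eqVlt ltnS => /orP[/eqP kN|lekN]; last first.
  by rewrite lekN (leq_trans lejk) // eG // lejk.
rewrite kN ltnn; case: leqP => [lejN|_] //; exact: fe.
Qed.

Lemma pos_rank1_hpd (c : R[i]) (v : 'cV[R[i]]_n) (a : R[i]) :
  0 < c -> 0 <= a -> hpd (c *: A + a *: (v *m v^t*)).
Proof.
move=> c_gt0 a_ge0; split.
  rewrite hermE !linearD /= map_mxD !linearZ /= !map_mxZ hpd_herm trmxC_mul trmxCK.
  by apply/eqP; congr (_ *: _ + _ *: _); apply: geC0_conj => //; apply: ltW.
move=> x x0; rewrite mulmxDl dotcDl -!scalemxAl !dotcZl -mulmxA rank1_mulmx.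
rewrite dotcZl (dotcC x v) -normCK.
by rewrite ltr_wpDr ?mulr_ge0 ?exprn_ge0 // mulr_gt0 //; apply: dotA_gt0.
Qed.

End EnergyForm.

(** * Preconditioners with a prescribed action on one vector *)

Lemma kappa_le (R : realType) (n : nat) (M : 'M[R[i]]_n) (lo hi : R) : 0 < lo ->
  (spectrum M !=set0)%classic ->
  (forall l, spectrum M l -> lo <= l <= hi) -> kappa M <= hi / lo.
Proof.
move=> lo_gt0 M0 Mlohi.
have hmax : lambda_max M <= hi by apply: ge_sup => // l /Mlohi /andP[].
have hmin : lo <= lambda_min M by apply: lb_le_inf => // l /Mlohi /andP[].
have hi_ge0 : 0 <= hi by case: M0 => l /Mlohi /andP[? ?]; lra.
rewrite /kappa ler_pdivrMr ?(lt_le_trans lo_gt0) //.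
rewrite mulrAC ler_pdivlMr //; apply: le_trans (_ : hi * lo <= _).
  by rewrite ler_pM2r.
by rewrite ler_wpM2l.
Qed.

Section Precond.
Variables (R : realType) (n : nat) (A : 'M[R[i]]_n).
Hypothesis hA : hpd A.

(** The preconditioner is that for which invmx B *m A is 1 - q S, with S the
    A-unitary reflection along e - f: S exchanges e and f because they have the
    same A-norm and a real inner product. *)
Lemma exists_precond (q : R) (e f : 'cV[R[i]]_n) : 0 < q < 1 ->
  dotA A f f = dotA A e e -> dotA A f e = dotA A e f -> e != f ->
  exists B, [/\ hpd B, kappa (invmx B *m A) <= (1 + q) / (1 - q)
    & invmx B *m (A *m e) = e - q%:C *: f].
Proof.
move=> /andP[q_gt0 q_lt1] ff_ee fe_ef nef.
pose v := e - f.
have v0 : v != 0 by rewrite subr_eq0.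
pose nu := dotA A v v.
have nu_gt0 : 0 < nu := dotA_gt0 hA v0.
have ev : 2 * dotA A e v = nu.
  by rewrite /nu {2}/v dotABl !dotABr // ff_ee fe_ef; ring.
have nu0 : nu != 0 by rewrite gt_eqF.
pose t := 2 * q%:C / nu.
pose C := (1 - q)%:C *: invmx A + t *: (v *m v^t*).
have hC : hpd C.
  apply: (pos_rank1_hpd (hpd_inv hA)); first by rewrite ltcR subr_gt0.
  by rewrite divr_ge0 ?(ltW nu_gt0) // mulr_ge0 // lecR ltW.
have CA : C *m A = (1 - q)%:C%:M + t *: (v *m (v^t* *m A)).
  rewrite /C mulmxDl -(scalemxAl _ (invmx A)) -(scalemxAl t).
  by rewrite (mulVmx (hpd_unit hA)) scalemx1 -(mulmxA v).
have vAv : (v^t* *m A *m v) 0 0 = nu by rewrite /nu /dotA /dotc mulmxA.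
have tnu : t * nu = 2 * q%:C by rewrite divfK.
exists (invmx C); split; first exact: hpd_inv.
  rewrite invmxK; apply: kappa_le; first by rewrite subr_gt0.
    (* The supremum and infimum bounds need a nonempty spectrum. *)
    exists (1 + q); apply/eigenvalueP; exists (v^t* *m A).
      rewrite CA mulmxDr mul_mx_scalar -scalemxAr (mulmxA _ v).
      rewrite [_ *m v]mx11_scalar vAv mul_scalar_mx scalerA tnu -scalerDl.
      by congr (_ *: _); rewrite !raddfD /= raddfN /=; ring.
    by apply: contra nu0 => /eqP vA0; rewrite -vAv vA0 mul0mx mxE.
  (* For a left eigenvector u, multiplying by v on the right gives l = 1 + q
     unless u *m v = 0, and in that case C *m A acts on u as 1 - q. *)
  move=> l /eigenvalueP[u].
  rewrite CA mulmxDr mul_mx_scalar -scalemxAr (mulmxA u) [u *m v]mx11_scalar.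
  rewrite mul_scalar_mx scalerA; set s := (u *m v) 0 0 => uE u0.
  have sE : (1 + q - l)%:C * s = 0.
    move/(congr1 (fun z => (z *m v) 0 0)): uE.
    rewrite mulmxDl -!scalemxAl mxE [X in X + _]mxE [X in _ + X]mxE [RHS]mxE.
    rewrite -/s vAv mulrAC tnu => sE.
    by rewrite rmorphB rmorphD /= mulrBl -sE rmorphB /=; ring.
  move/eqP: sE; rewrite mulf_eq0 => /orP[l_hi|/eqP s0].
    by move: l_hi; rewrite (inj_eq (@complexI _)) => /eqP; lra.
  move/eqP: uE; rewrite s0 mulr0 scale0r addr0 -subr_eq0 -scalerBl scaler_eq0.
  rewrite (negPf u0) orbF -rmorphB (inj_eq (@complexI _)) => /eqP; lra.
rewrite invmxK mulmxA CA mulmxDl mul_scalar_mx -scalemxAl -!mulmxA rank1_mulmx.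
have -> : dotc (A *m e) v = nu / 2 by rewrite -ev /dotA; field.
rewrite scalerA.
have -> : t * (nu / 2) = q%:C by rewrite mulrA tnu; field.
by rewrite /v scalerBr raddfB /= scalerBl scale1r addrA subrK.
Qed.

(** The hypotheses say that f = e' / q has the A-norm of e and a real inner
    product with it, as the reflection requires. *)
Lemma exists_step_precond (q : R) (c : R[i]) (e e' : 'cV[R[i]]_n) :
  0 < q < 1 -> 0 < c -> dotA A e e = c ->
  dotA A e' e = q%:C * (q%:C * c) -> dotA A e' e' = q%:C * (q%:C * c) ->
  exists B, [/\ hpd B, kappa (invmx B *m A) <= (1 + q) / (1 - q)
    & invmx B *m (A *m e) = e - e'].
Proof.
move=> q01 c_gt0 ee e'e e'e'; have /andP[q_gt0 q_lt1] := q01.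
have q0 : q%:C != 0 by rewrite gt_eqF // ltcR.
have qV : (q%:C^-1)^*%R = q%:C^-1 by rewrite geC0_conj // invr_ge0 lecR ltW.
have ee' : dotA A e e' = q%:C * (q%:C * c).
  by rewrite dotAC // e'e geC0_conj // !mulr_ge0 ?lecR // ltW.
pose f := q%:C^-1 *: e'.
have fe : dotA A f e = q%:C * c by rewrite dotAZl e'e mulKf.
have ef : dotA A e f = q%:C * c by rewrite dotAZr // qV ee' mulKf.
have ff : dotA A f f = c.
  by rewrite dotAZl dotAZr // qV e'e' !mulKf.
have nef : e != f.
  apply/eqP => eqef; move: ef; rewrite -eqef ee => cE.
  have : q%:C * c < c by rewrite gtr_pMl // ltcR.
  by rewrite -cE ltxx.
have [||B [hB kB Be]] := @exists_precond q e f q01 _ _ nef.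
- by rewrite ff ee.
- by rewrite fe ef.
by exists B; split=> //; rewrite Be scalerA divff // scale1r.
Qed.

End Precond.

(** * The method on a prescribed error curve *)

Lemma contraction_factor (R : realFieldType) (kappa : R) : 1 < kappa ->
  let q := (kappa - 1) / (kappa + 1) in
  0 < q < 1 /\ (1 + q) / (1 - q) = kappa.
Proof.
move=> kappa_gt1 q; split; last by rewrite /q; field; lra.
by apply/andP; split; [apply: divr_gt0 | rewrite ltr_pdivrMr ?mul1r]; lra.
Qed.

(** The preconditioned residual is the increment e k - e k.+1.  The Gram matrix
    makes the increments A-orthogonal, so the recurrence subtracts nothing for
    any [m], and makes the exact line search stop at e k.+1. *)
Lemma pcg_follows (R : realType) (n : nat) (A : 'M[R[i]]_n)
    (b x0 : 'cV[R[i]]_n) (B : nat -> 'M[R[i]]_n) (e : nat -> 'cV[R[i]]_n)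
    (g : nat -> R[i]) (N : nat) (m : nat -> nat) :
  hpd A -> e 0%N = invmx A *m b - x0 ->
  (forall j k, (j <= k <= N)%N -> dotA A (e k) (e j) = g k) ->
  (forall k, g k.+1 < g k) ->
  (forall k, (k < N)%N -> invmx (B k) *m (A *m e k) = e k - e k.+1) ->
  (forall k, (k < N)%N -> pcg_p A b B m x0 k = pcg_s A b B m x0 k) /\
  (forall k, (k <= N)%N -> pcg_error A b B m x0 k = e k).
Proof.
move=> hA e0 eG g_lt Be.
have eGr j k : (j <= k <= N)%N -> dotA A (e j) (e k) = g k.
  move=> /andP[lejk lekN]; rewrite dotAC // eG ?lejk //.
  by rewrite -(eG k k) ?leqnn // -dotAC.
have de k : (k < N)%N -> dotA A (e k.+1) (e k - e k.+1) = 0.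
  by move=> ltkN; rewrite dotABr // !eG ?subrr ?leqnn ?leqnSn.
have d0 k : (k < N)%N -> dotA A (e k - e k.+1) (e k - e k.+1) != 0.
  move=> ltkN; rewrite dotABl de // subr0 dotABr // (eG k k); last first.
    by rewrite leqnn ltnW.
  by rewrite eGr ?leqnSn // subr_eq0 gt_eqF.
have dd l k : (l < k < N)%N -> dotA A (e k - e k.+1) (e l - e l.+1) = 0.
  move=> /andP[ltlk ltkN]; rewrite dotABl !dotABr //.
  rewrite (eG l k) ?(eG l.+1 k) ?(eG l k.+1) ?(eG l.+1 k.+1) ?subrr //.
  - by rewrite leqW.
  - by rewrite (leqW (ltnW ltlk)).
  - by rewrite ltlk ltnW.
  - by rewrite (ltnW ltlk) ltnW.
have rE k : pcg_error A b B m x0 k = e k -> pcg_r A b B m x0 k = A *m e k.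
  by move=> <-; rewrite /pcg_error mulmxBr mulKVmx ?hpd_unit.
have sE k : (k < N)%N -> pcg_error A b B m x0 k = e k ->
    pcg_s A b B m x0 k = e k - e k.+1.
  by move=> ltkN ek; rewrite pcg_sE rE // Be.
have main k : (k <= N)%N -> pcg_error A b B m x0 k = e k /\
    forall l, (l < k)%N -> pcg_p A b B m x0 l = e l - e l.+1.
  elim: k => [|k IHk] lekN; first by split; rewrite // /pcg_error pcg_x0.
  have [ek pl] := IHk (ltnW lekN).
  have pk : pcg_p A b B m x0 k = e k - e k.+1.
    rewrite pcg_pE sE // big_nat big1 ?subr0 // => l /andP[_ ltlk].
    by rewrite pl // -/(dotA A _ _) dd ?ltlk // mul0r scale0r.
  have rk : pcg_r A b B m x0 k = A *m (e k - e k.+1 + e k.+1).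
    by rewrite subrK rE.
  split=> [|l]; last by rewrite ltnS leq_eqVlt => /orP[/eqP ->|/pl].
  rewrite /pcg_error pcg_xS pk rk -!/(dotA A _ _) dotADl de // addr0.
  by rewrite divff ?d0 // scale1r opprD addrA -/(pcg_error _ _ _ _ _ _) ek subKr.
split=> k lekN; last by case: (main k lekN).
have [ek _] := main k (ltnW lekN); have [_ pl] := main k.+1 lekN.
by rewrite pl // sE.
Qed.

Theorem theorem6p4 (R : realType) (n : nat) (A : 'M[R[i]]_n)
    (b x0 : 'cV[R[i]]_n) (kappa_max : R) (N : nat)
    (hA : hpd A) (hx0 : x0 <> invmx A *m b) (hkappa : 1 < kappa_max)
    (hN1 : (1 <= N)%N) (hNn : (N < n)%N) :
  exists B : nat -> 'M[R[i]]_n,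
    (forall k : nat, (k < N)%N ->
       hpd (B k) /\ kappa (invmx (B k) *m A) <= kappa_max) /\
    (forall m : nat -> nat,
       (forall k : nat, (m k <= k)%N) ->
       (forall k : nat, (m k.+1 <= m k + 1)%N) ->
       (forall k : nat, (k < N)%N -> pcg_p A b B m x0 k = pcg_s A b B m x0 k) /\
       (forall k : nat, (k <= N)%N -> pcg_x A b B m x0 k = psd_x A b B x0 k) /\
       (forall k : nat, (k < N)%N ->
          normA A (pcg_error A b B m x0 k.+1) / normA A (pcg_error A b B m x0 k)
          = (kappa_max - 1) / (kappa_max + 1))).
Proof.
set q := (kappa_max - 1) / (kappa_max + 1).
have [q01 kappaE] := contraction_factor hkappa.
rewrite -/q in q01 kappaE; have /andP[q_gt0 q_lt1] := q01.
pose e0 := invmx A *m b - x0.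
have e0_neq0 : e0 != 0 by rewrite subr_eq0 eq_sym; apply/eqP.
have [g [g0 g_gt0 gS]] : exists g : nat -> R[i], [/\ g 0%N = dotA A e0 e0,
    forall k, 0 < g k & forall k, g k.+1 = q%:C * (q%:C * g k)].
  exists (fun k => iter k (fun c => q%:C * (q%:C * c)) (dotA A e0 e0)).
  split=> //; elim=> [|k IHk] /=; first exact: dotA_gt0.
  by rewrite !mulr_gt0 ?ltcR.
have g_lt k : g k.+1 < g k.
  by rewrite gS mulrA -rmorphM /= gtr_pMl // ltcR mulr_ilt1 ?ltW.
have [e e0E eG] := exists_dotA_gram hA g0 g_gt0 (fun k => ltW (g_lt k)) hNn.
have eGd k : (k <= N)%N -> dotA A (e k) (e k) = g k.
  by move=> lekN; rewrite eG ?leqnn.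
have exB k : exists B, (k < N)%N -> [/\ hpd B, kappa (invmx B *m A) <= kappa_max
    & invmx B *m (A *m e k) = e k - e k.+1].
  have [ltkN|_] := ltnP k N; last by exists 0.
  have [||B BP] := exists_step_precond hA q01 (g_gt0 k) (eGd k (ltnW ltkN))
    (e' := e k.+1).
  - by rewrite -gS eG // leqnSn.
  - by rewrite -gS eGd.
  by exists B; rewrite -kappaE.
have [B BP] := choice exB.
exists B; split=> [k /BP[] //|m _ _].
have Be k : (k < N)%N -> invmx (B k) *m (A *m e k) = e k - e k.+1.
  by move=> /BP[].
have follows m' := @pcg_follows R n A b x0 B e g N m' hA e0E eG g_lt Be.
have [ps er] := follows m; split=> //; split=> k lekN.
  have := er k lekN; have [_ <- //] := follows (fun=> 0%N).
  by rewrite /pcg_error => /addrI /oppr_inj.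
rewrite !er ?(ltnW lekN) // /normA !eGd ?(ltnW lekN) // gS.
rewrite -(RRe_real (gtr0_real (g_gt0 k))) -!rmorphM /= mulrA -expr2.
rewrite sqrtrM ?sqr_ge0 // sqrtr_sqr ger0_norm ?ltW // mulfK // gt_eqF //.
by rewrite sqrtr_gt0; have := g_gt0 k; rewrite ltcE => /andP[].
Qed.
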